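(* Let $U_7^3=\{L(C)\in TLeib_7 : c_{2,3}\neq 0,\ c_{1,1}=c_{0,1}=0,\ c_{1,2}\neq 0,\ c_{0,0}\neq 0\}$. 1. Two algebras $L(C)$ and $L(C')$ from $U_7^3$ are isomorphic if and only if $\frac{c'_{1,2}}{c'_{2,3}}=\frac{c_{1,2}}{c_{2,3}}$. 2. For any $\lambda\in\mathbb{C}^*=\mathbb{C}\setminus\{0\}$ there exists $L(C)\in U_7^3$ with $\frac{c_{1,2}}{c_{2,3}}=\lambda$. Moreover, the orbits (isomorphism classes) in $U_7^3$ are parameterized by the algebras $L(1,0,0,\lambda,0,0,1)$, $\lambda\in\mathbb{C}^*$: these algebras lie in $U_7^3$ and every algebra in $U_7^3$ is isomorphic to one of them.
   Context: All algebras are over $\mathbb{C}$. For $C=(c_{0,0},c_{0,1},c_{1,1},c_{1,2},c_{1,3},c_{1,4},c_{2,3})\in\mathbb{C}^7$, $L(C)$ denotes the $7$-dimensional complex (Leibniz) algebra with basis $e_0,e_1,\dots,e_6$ and products (products of basis vectors not listed are zero): $[e_i,e_0]=e_{i+1}$ for $1\le i\le 5$; $[e_0,e_i]=-e_{i+1}$ for $2\le i\le 5$; $[e_0,e_0]=c_{0,0}e_6$; $[e_0,e_1]=-e_2+c_{0,1}e_6$; $[e_1,e_1]=c_{1,1}e_6$; $[e_1,e_2]=-[e_2,e_1]=c_{1,2}e_4+c_{1,3}e_5+c_{1,4}e_6$; $[e_1,e_3]=-[e_3,e_1]=c_{1,2}e_5+c_{1,3}e_6$; $[e_1,e_4]=-[e_4,e_1]=(c_{1,2}-c_{2,3})e_6$;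 $[e_2,e_3]=-[e_3,e_2]=c_{2,3}e_6$. $TLeib_7$ is the set of all $L(C)$, $C\in\mathbb{C}^7$. The entries of $C'$ are denoted $c'_{i,j}$, in the same order. ''Isomorphic'' means isomorphic as algebras over $\mathbb{C}$; an orbit is an isomorphism class. *)

(* Defs.v *)
From HB Require Import structures.
From mathcomp Require Import all_boot all_order all_algebra sesquilinear.
From mathcomp Require Export reals complex.

Set Implicit Arguments.
Unset Strict Implicit.
Unset Printing Implicit Defensive.

Import GRing.Theory.
Local Open Scope ring_scope.

(* An algebra (not assumed associative or unital) is a K-vector space with a
   bilinear product. *)
Definition alg_isomorphic (K : fieldType) (U V : lmodType K)
    (mulU : {bilinear U -> U -> U}) (mulV : {bilinear V -> V -> V}) : Prop :=
  exists f : {linear U -> V},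
    bijective f /\ forall x y : U, f (mulU x y) = mulV (f x) (f y).

Record params (K : Type) : Type := Params {
  c00 : K; c01 : K; c11 : K; c12 : K; c13 : K; c14 : K; c23 : K
}.

(* The basis vector e_k of K^7; meaningful only for k <= 6. *)
Definition e (K : fieldType) (k : nat) : 'rV[K]_7 := delta_mx 0 (inord k).

(* The product [e_i, e_j] in L(C). *)
Definition basis_prod (K : fieldType) (C : params K) (i j : nat) : 'rV[K]_7 :=
  match i, j with
  | 1%N, 0%N => e K 2
  | 2%N, 0%N => e K 3
  | 3%N, 0%N => e K 4
  | 4%N, 0%N => e K 5
  | 5%N, 0%N => e K 6
  | 0%N, 2%N => - e K 3
  | 0%N, 3%N => - e K 4
  | 0%N, 4%N => - e K 5
  | 0%N, 5%N => - e K 6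
  | 0%N, 0%N => c00 C *: e K 6
  | 0%N, 1%N => - e K 2 + c01 C *: e K 6
  | 1%N, 1%N => c11 C *: e K 6
  | 1%N, 2%N => c12 C *: e K 4 + c13 C *: e K 5 + c14 C *: e K 6
  | 2%N, 1%N => - (c12 C *: e K 4 + c13 C *: e K 5 + c14 C *: e K 6)
  | 1%N, 3%N => c12 C *: e K 5 + c13 C *: e K 6
  | 3%N, 1%N => - (c12 C *: e K 5 + c13 C *: e K 6)
  | 1%N, 4%N => (c12 C - c23 C) *: e K 6
  | 4%N, 1%N => - ((c12 C - c23 C) *: e K 6)
  | 2%N, 3%N => c23 C *: e K 6
  | 3%N, 2%N => - (c23 C *: e K 6)
  | _, _ => 0
  end.

(* The algebra L(C), given by its product on K^7. *)
Definition L (K : fieldType) (C : params K) (x y : 'rV[K]_7) : 'rV[K]_7 :=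
  \sum_(i < 7) \sum_(j < 7) (x 0 i * y 0 j) *: basis_prod C i j.

Lemma L_basis (K : fieldType) (C : params K) (i j : 'I_7) :
  L C (e K i) (e K j) = basis_prod C i j.
Proof.
rewrite /L (bigD1 i) //= (bigD1 j) //= !mxE !inord_val !eqxx mulr1 scale1r.
rewrite big1 ?addr0 => [|k /negPf kj]; last by rewrite !mxE !inord_val kj andbF mulr0 scale0r.
rewrite big1 ?addr0 // => k /negPf ki.
by rewrite big1 // => l _; rewrite !mxE !inord_val ki andbF mul0r scale0r.
Qed.

Lemma L_bilinear (K : fieldType) (C : params K) :
  bilinear_for *:%R *:%R (L C).
Proof.
split=> [y | x] a u v /=; rewrite /L scaler_sumr -big_split /=;
  apply: eq_bigr => i _; rewrite scaler_sumr -big_split /=;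
  apply: eq_bigr => j _; rewrite scalerA -scalerDl !mxE; congr (_ *: _).
  by rewrite mulrDl mulrA.
by rewrite mulrDr mulrCA.
Qed.

HB.instance Definition _ (K : fieldType) (C : params K) :=
  bilinear_isBilinear.Build K 'rV[K]_7 'rV[K]_7 'rV[K]_7 *:%R *:%R (L C)
    (L_bilinear C).

(* U_7^3 as a set of parameters: C is determined by the product of L(C). *)
Definition U73 (K : fieldType) (C : params K) : Prop :=
  c23 C != 0 /\ (c11 C = 0 /\ c01 C = 0) /\ c12 C != 0 /\ c00 C != 0.

(* Main.v *)
From HB Require Import structures.
Require Import Defs.
From mathcomp Require Import all_boot all_order all_algebra.
From mathcomp Require Import sesquilinear ring.

Set Implicit Arguments.
Unset Strict Implicit.
Unset Printing Implicit Defensive.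

Import GRing.Theory Num.Theory.
Local Open Scope ring_scope.

(** The ratio [c12 / c23] is an invariant. Let [f] be an isomorphism from [L C]
onto [L C'], and let [x], [y] be the images of [e_0], [e_1]. Since
[[e_1, e_1] = 0] in [L C], the square of [y] vanishes; but in [L C'] that
square is [c'00 y_0^2 e_6], so [y_0 = 0] ([entry_y0]). From then on
[f e_(k+1) = [f e_k, x]] is triangular for the basis [e_1, ..., e_6], with
leading term [y_1 x_0^k e_(k+1)] ([morph_leading]), and the leading terms of
the images of [[e_1, e_2]] and [[e_2, e_3]] give
[c'12 y_1 = c12 x_0^2] and [c'23 y_1 = c23 x_0^2] ([morph_c12], [morph_c23]).
Both parameters are multiplied by the same nonzero factor.

Conversely, each [L C] in the family is brought to
[L (1, 0, 0, c12 / c23, 0, 0, 1)] by three changes of basis ([normal_form]).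
Replacing [e_0] by [e_0 + a e_1] adds [2 a c12^2] to [c13], so a suitable [a]
kills [c13] ([iso_shear0]). Replacing [e_1] by [e_1 + b e_3] then subtracts
[2 b c23] from [c14] and changes nothing else ([iso_shear1]). Finally
[e_0 -> t e_0], [e_1 -> u e_1] rescales the three remaining parameters
([iso_scale]), and making [c00 = c23 = 1] amounts to [t^5 = c00 c23] and
[u = t^2 / c23]; this is where an algebraically closed field enters.
Algebras with the same ratio share their normal form. *)

(** * Coordinates *)

Definition vec (K : fieldType) (s : seq K) : 'rV[K]_7 := \row_(j < 7) s`_j.

(** Indexing by [nat] lets numerals be used directly and keeps the inhabitants
of ['I_7] out of the computations. *)
Definition entry (K : fieldType) (x : 'rV[K]_7) (k : nat) : K := x 0 (inord k).

Lemma forall_ord7 (P : 'I_7 -> Prop) :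
  P (inord 0) -> P (inord 1) -> P (inord 2) -> P (inord 3) -> P (inord 4) ->
  P (inord 5) -> P (inord 6) -> forall i, P i.
Proof.
move=> P0 P1 P2 P3 P4 P5 P6 i; rewrite -(inord_val i).
by case: i => [[|[|[|[|[|[|[|k]]]]]]]].
Qed.

Lemma sum7 (V : nmodType) (F : 'I_7 -> V) :
  \sum_(i < 7) F i =
  F (inord 0) + F (inord 1) + F (inord 2) + F (inord 3) + F (inord 4)
  + F (inord 5) + F (inord 6).
Proof.
rewrite !big_ord_recr big_ord0 /= add0r.
by do !congr (_ + _); congr F; apply: val_inj; rewrite /= inordK.
Qed.

Lemma entry_vec (K : fieldType) (s : seq K) (k : nat) :
  (k < 7)%N -> entry (vec s) k = s`_k.
Proof. by move=> k7; rewrite /entry mxE inordK. Qed.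

Lemma entry_e (K : fieldType) (i k : nat) :
  (i < 7)%N -> (k < 7)%N -> entry (e K i) k = (k == i)%:R.
Proof.
by move=> i7 k7; rewrite /entry mxE eqxx -val_eqE /= !inordK.
Qed.

Lemma entry_ext (K : fieldType) (x y : 'rV[K]_7) :
  entry x 0 = entry y 0 -> entry x 1 = entry y 1 -> entry x 2 = entry y 2 ->
  entry x 3 = entry y 3 -> entry x 4 = entry y 4 -> entry x 5 = entry y 5 ->
  entry x 6 = entry y 6 -> x = y.
Proof. by move=> *; apply/rowP; apply: forall_ord7. Qed.

Lemma entry0 (K : fieldType) (k : nat) : entry (0 : 'rV[K]_7) k = 0.
Proof. by rewrite /entry mxE. Qed.

(** Up to the squares of [e_0] and [e_1] and the term [c01], the product is
antisymmetric, hence the 2 x 2 minors [w i j] of the pair [x], [y]. *)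
Lemma L_vec (K : fieldType) (C : params K) (x y : 'rV[K]_7) :
  let w i j := entry x i * entry y j - entry x j * entry y i in
  L C x y = vec
    [:: 0; 0; w 1%N 0%N; w 2%N 0%N;
        w 3%N 0%N + c12 C * w 1%N 2%N;
        w 4%N 0%N + c13 C * w 1%N 2%N + c12 C * w 1%N 3%N;
        w 5%N 0%N + c00 C * (entry x 0 * entry y 0)
          + c01 C * (entry x 0 * entry y 1) + c11 C * (entry x 1 * entry y 1)
          + c14 C * w 1%N 2%N + c13 C * w 1%N 3%N
          + (c12 C - c23 C) * w 1%N 4%N + c23 C * w 2%N 3%N].
Proof.
move=> w; rewrite /L sum7 !sum7 !inordK //= !scaler0 !addr0 ?add0r.
by apply: entry_ext; rewrite entry_vec //= /w /entry !mxE !eqxx -!val_eqE /=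
  !inordK //=; ring.
Qed.

(** * Isomorphisms *)

Lemma alg_isomorphic_sym (K : fieldType) (U V : lmodType K)
    (mulU : {bilinear U -> U -> U}) (mulV : {bilinear V -> V -> V}) :
  alg_isomorphic mulU mulV -> alg_isomorphic mulV mulU.
Proof.
case=> f [[g fK gK] fM].
have g_linear : linear g by exact: can2_linear fK gK.
pose g_isLinear := GRing.isLinear.Build K V U *:%R g g_linear.
pose g' : {linear V -> U} := HB.pack g g_isLinear.
exists g'; split; first by exists f.
by move=> x y /=; rewrite -{1}[x]gK -{1}[y]gK -fM fK.
Qed.

Lemma alg_isomorphic_trans (K : fieldType) (U V W : lmodType K)
    (mulU : {bilinear U -> U -> U}) (mulV : {bilinear V -> V -> V})
    (mulW : {bilinear W -> W -> W}) :
  alg_isomorphic mulU mulV -> alg_isomorphic mulV mulW ->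
  alg_isomorphic mulU mulW.
Proof.
case=> f [f_bij fM] [g [g_bij gM]]; exists (g \o f); split.
  exact: bij_comp.
by move=> x y /=; rewrite fM gM.
Qed.

(** Row [i] of [M] is the image of [e_i]. Upper triangular matrices suffice, as
all the changes of basis below send [e_i] into the span of [e_i, ..., e_6]. *)
Lemma alg_isomorphic_of_mx (K : fieldType) (C C' : params K) (M : 'M[K]_7) :
  is_trig_mx M^T -> (forall i, M i i != 0) ->
  (forall x y, L C x y *m M = L C' (x *m M) (y *m M)) ->
  alg_isomorphic (L C) (L C').
Proof.
move=> M_trig M_diag M_mul; exists (mulmxr M); split; last exact: M_mul.
have M_unit : M \in unitmx.
  rewrite unitmxE -det_tr (det_trig M_trig) unitfE.
  by apply/prodf_neq0 => i _; rewrite mxE.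
by exists (mulmxr (invmx M)) => x /=; rewrite ?mulmxK ?mulmxKV.
Qed.

Definition mx_of_rows (K : fieldType) (rows : seq (seq K)) : 'M[K]_7 :=
  \matrix_(i < 7) vec (nth [::] rows i).

Lemma entry_mulmx_rows (K : fieldType) (x : 'rV[K]_7) (rows : seq (seq K))
    (k : nat) :
  (k < 7)%N ->
  entry (x *m mx_of_rows rows) k =
  entry x 0 * (nth [::] rows 0)`_k + entry x 1 * (nth [::] rows 1)`_k
  + entry x 2 * (nth [::] rows 2)`_k + entry x 3 * (nth [::] rows 3)`_k
  + entry x 4 * (nth [::] rows 4)`_k + entry x 5 * (nth [::] rows 5)`_k
  + entry x 6 * (nth [::] rows 6)`_k.
Proof. by move=> k7; rewrite /entry mxE sum7 !mxE !inordK. Qed.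

(** * Changes of basis *)

(** Comparing entries at generic [x] and [y], instead of treating the pairs of
basis vectors one by one, leaves only polynomial identities. *)
Ltac check_product :=
  move=> x y; apply: entry_ext;
  rewrite entry_mulmx_rows // !L_vec !entry_vec //= ?entry_mulmx_rows //=;
  ring.

(** Replacing [e_0] by [e_0 + a e_1]: the new basis is obtained from it and [e_1]
by iterating [e_(k+1) = [e_k, e_0]], which gives the rows of the matrix. The
parameter [c13] receives [2 a c12^2] because [e_4] becomes
[e_4 - 2 a c12 e_5 + ...] while [[e_1, e_2]] does not change. The
value that [c14] takes is removed afterwards by [iso_shear1]. *)
Lemma iso_shear0 (K : fieldType) (a d b2 b3 b4 s : K) :
  alg_isomorphic
    (L (Params d 0 0 b2 (b3 + 2 * a * b2 ^+ 2)
          (b4 + 2 * a * b2 * b3 - a ^+ 2 * b2 ^+ 2 * (b2 - s)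
           + a * (3 * b2 - s) * (b3 + 2 * a * b2 ^+ 2)) s))
    (L (Params d 0 0 b2 b3 b4 s)).
Proof.
apply: (@alg_isomorphic_of_mx _ _ _ (mx_of_rows
  [:: [:: 1; a; 0; 0; 0; 0; 0];
      [:: 0; 1; 0; 0; 0; 0; 0];
      [:: 0; 0; 1; 0; 0; 0; 0];
      [:: 0; 0; 0; 1; - (a * b2); - (a * b3); - (a * b4)];
      [:: 0; 0; 0; 0; 1; - (2 * a * b2);
          - (2 * a * b3) + a ^+ 2 * b2 * (b2 - s)];
      [:: 0; 0; 0; 0; 0; 1; - (a * (3 * b2 - s))];
      [:: 0; 0; 0; 0; 0; 0; 1]])); last by check_product.
- by apply/is_trig_mxP; do 2 apply: forall_ord7; rewrite !mxE !inordK.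
- by apply: forall_ord7; rewrite !mxE !inordK //= oner_neq0.
Qed.

(** Replacing [e_1] by [e_1 + b e_3]: [[e_1, e_2]] gains
[b [e_1, e_4] + b [e_3, e_2] = b (c12 - 2 c23) e_6], of which [b c12 e_6] is
absorbed by the new vector [e_4 + b e_6]. *)
Lemma iso_shear1 (K : fieldType) (b d b2 b3 b4 s : K) :
  alg_isomorphic
    (L (Params d 0 0 b2 b3 (b4 - 2 * b * s) s))
    (L (Params d 0 0 b2 b3 b4 s)).
Proof.
apply: (@alg_isomorphic_of_mx _ _ _ (mx_of_rows
  [:: [:: 1; 0; 0; 0; 0; 0; 0];
      [:: 0; 1; 0; b; 0; 0; 0];
      [:: 0; 0; 1; 0; b; 0; 0];
      [:: 0; 0; 0; 1; 0; b; 0];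
      [:: 0; 0; 0; 0; 1; 0; b];
      [:: 0; 0; 0; 0; 0; 1; 0];
      [:: 0; 0; 0; 0; 0; 0; 1]])); last by check_product.
- by apply/is_trig_mxP; do 2 apply: forall_ord7; rewrite !mxE !inordK.
- by apply: forall_ord7; rewrite !mxE !inordK //= oner_neq0.
Qed.

(** Replacing [e_0] by [t e_0] and [e_1] by [u e_1], so that [e_k] becomes
[t^(k-1) u e_k]. The two sides are scaled so as to avoid denominators. *)
Lemma iso_scale (K : fieldType) (t u d b2 b3 b4 s : K) :
  t != 0 -> u != 0 ->
  alg_isomorphic
    (L (Params d 0 0 (b2 * u) (b3 * u) (b4 * u) (s * u)))
    (L (Params (d * t ^+ 3 * u) 0 0
          (b2 * t ^+ 2) (b3 * t ^+ 3) (b4 * t ^+ 4) (s * t ^+ 2))).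
Proof.
move=> t0 u0.
apply: (@alg_isomorphic_of_mx _ _ _ (mx_of_rows
  [:: [:: t; 0; 0; 0; 0; 0; 0];
      [:: 0; u; 0; 0; 0; 0; 0];
      [:: 0; 0; t * u; 0; 0; 0; 0];
      [:: 0; 0; 0; t ^+ 2 * u; 0; 0; 0];
      [:: 0; 0; 0; 0; t ^+ 3 * u; 0; 0];
      [:: 0; 0; 0; 0; 0; t ^+ 4 * u; 0];
      [:: 0; 0; 0; 0; 0; 0; t ^+ 5 * u]])); last by check_product.
- by apply/is_trig_mxP; do 2 apply: forall_ord7; rewrite !mxE !inordK.
- by apply: forall_ord7; rewrite !mxE !inordK //= ?mulf_neq0 ?expf_neq0.
Qed.

(** * The normal form *)

Lemma normal_form (F : numClosedFieldType) (C : params F) :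
  U73 C ->
  alg_isomorphic (L C) (L (Params 1 0 0 (c12 C / c23 C) 0 0 1)).
Proof.
case: C => d q p b2 b3 b4 s [/= s0 [[-> ->] [b20 d0]]].
pose a := - b3 / (2 * b2 ^+ 2).
have a3 : b3 + 2 * a * b2 ^+ 2 = 0 by rewrite /a; field.
have := iso_shear0 a d b2 b3 b4 s; rewrite a3.
set b4' := (X in Params _ _ _ _ _ X) => iso0.
apply: alg_isomorphic_trans (alg_isomorphic_sym iso0) _.
pose b := b4' / (2 * s).
have b40 : b4' - 2 * b * s = 0 by rewrite /b; field.
have := iso_shear1 b d b2 0 b4' s; rewrite b40.
move=> iso1; apply: alg_isomorphic_trans (alg_isomorphic_sym iso1) _.
pose t := 5.-root (d * s).
have t5 : t ^+ 5 = d * s by rewrite rootCK.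
have t0 : t != 0 by rewrite rootC_eq0 // mulf_neq0.
pose u := t ^+ 2 / s.
have u0 : u != 0 by rewrite mulf_neq0 ?expf_neq0 ?invr_eq0.
(* The source parameters are chosen so that the target is (d, b2, s); their
   multiples by u are then b2 / s and 1. *)
have := iso_scale 1 (b2 / t ^+ 2) 0 0 (s / t ^+ 2) t0 u0.
have -> : 1 * t ^+ 3 * u = d.
  by rewrite mul1r /u mulrA -exprD t5 mulfK.
have -> : b2 / t ^+ 2 * u = b2 / s by rewrite /u; field; rewrite s0 t0.
have -> : s / t ^+ 2 * u = 1 by rewrite /u; field; rewrite s0 t0.
rewrite !divfK ?expf_neq0 // !mul0r.
exact: alg_isomorphic_sym.
Qed.

(** * The invariant *)

(** On the span of [e_1, ..., e_6], right multiplication by [x] is [x_0] times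
the shift [e_k -> e_(k+1)], plus terms that raise the index by at least 2. *)
Lemma L_e0_leading (K : fieldType) (C : params K) (x z : 'rV[K]_7) (k : nat) :
  (0 < k < 6)%N -> (forall j, (j < k)%N -> entry z j = 0) ->
  (forall j, (j < k.+1)%N -> entry (L C z x) j = 0) /\
  entry (L C z x) k.+1 = entry z k * entry x 0.
Proof.
case: k => [|[|[|[|[|[|k]]]]]] // _ z_low; rewrite L_vec;
  (split; [case=> [|[|[|[|[|[|j]]]]]] // _|]);
  rewrite !entry_vec // (z_low 0 isT) /=;
  try rewrite (z_low 1 isT); try rewrite (z_low 2 isT);
  try rewrite (z_low 3 isT); try rewrite (z_low 4 isT); ring.
Qed.

Section Necessity.

Variables (K : fieldType) (C C' : params K) (f : {linear 'rV[K]_7 -> 'rV[K]_7}).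
Hypotheses (f_inj : injective f) (fM : {morph f : x y / L C x y >-> L C' x y}).
Hypotheses (C11 : c11 C = 0) (C'00 : c00 C' != 0).
Hypotheses (C'01 : c01 C' = 0) (C'11 : c11 C' = 0).

Let x := f (e K 0).
Let y := f (e K 1).

Lemma morph_basis_prod (i j : nat) :
  (i < 7)%N -> (j < 7)%N ->
  f (basis_prod C i j) = L C' (f (e K i)) (f (e K j)).
Proof.
move=> i7 j7; rewrite -fM.
by rewrite -(L_basis C (Ordinal i7) (Ordinal j7)).
Qed.

(** As [c'00 <> 0], a vector of square zero in [L C'] cannot involve [e_0]; and
[e_1] has square zero in [L C]. *)
Lemma entry_y0 : entry y 0 = 0.
Proof.
have /(congr1 (fun v => entry v 6)) := @morph_basis_prod 1 1 isT isT.
rewrite /= C11 scale0r linear0 L_vec entry_vec //= -/y /entry mxE C'01 C'11.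
move=> sq; have : c00 C' * (entry y 0 * entry y 0) = 0.
  by rewrite [RHS]sq /entry; ring.
by move/eqP; rewrite !mulf_eq0 (negPf C'00) orbb => /eqP.
Qed.

(** Induction through [e_(k+1) = [e_k, e_0]], starting from [y_0 = 0]. *)
Lemma morph_leading (k : nat) :
  (k < 6)%N ->
  (forall j, (j < k.+1)%N -> entry (f (e K k.+1)) j = 0) /\
  entry (f (e K k.+1)) k.+1 = entry y 1 * entry x 0 ^+ k.
Proof.
elim: k => [_|k IHk k6].
  by split=> [[]// _|]; rewrite ?entry_y0 ?mulr1.
have [low lead] := IHk (ltnW k6).
have -> : f (e K k.+2) = L C' (f (e K k.+1)) x.
  rewrite -morph_basis_prod //; last by rewrite ltnS ltnW.
  by case: k k6 {IHk low lead} => [|[|[|[|[|k]]]]].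
rewrite exprSr mulrA -lead.
by apply: L_e0_leading.
Qed.

(** Otherwise the leading coefficient of the image of [e_6], which is its only
possibly nonzero entry, would vanish. *)
Lemma leading_neq0 : entry y 1 != 0 /\ entry x 0 != 0.
Proof.
apply/andP; rewrite -negb_or; apply/negP => yx0.
have [low lead] := @morph_leading 5 isT.
have f6 : f (e K 6) = f 0.
  rewrite linear0; apply: entry_ext; rewrite ?lead ?low // ?entry0 //.
  by case/orP: yx0 => /eqP ->; rewrite ?mul0r ?expr0n ?mulr0.
move/f_inj/(congr1 (fun v => entry v 6)): f6.
by rewrite entry_e // entry0 => /eqP; rewrite oner_eq0.
Qed.

(** Compare the coefficients of [e_4] in the two expressions of the image
of [[e_1, e_2]]. *)
Lemma morph_c12 : c12 C' * entry y 1 = c12 C * entry x 0 ^+ 2.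
Proof.
have [y1 x0] := leading_neq0.
have /(congr1 (fun v => entry v 4)) := @morph_basis_prod 1 2 isT isT.
rewrite /= !linearD !linearZ L_vec entry_vec //= -/y entry_y0.
have [low2 lead2] := @morph_leading 1 isT.
have [_ lead4] := @morph_leading 3 isT.
have [low5 _] := @morph_leading 4 isT.
have [low6 _] := @morph_leading 5 isT.
have -> : entry (c12 C *: f (e K 4) + c13 C *: f (e K 5) + c14 C *: f (e K 6)) 4
  = c12 C * entry (f (e K 4)) 4 + c13 C * entry (f (e K 5)) 4
    + c14 C * entry (f (e K 6)) 4 by rewrite /entry !mxE.
rewrite (low2 0) // (low2 1) // lead2 lead4 low5 // low6 // => eq4.
apply: (mulfI x0); apply: (mulfI y1).
transitivity (c12 C * (entry y 1 * entry x 0 ^+ 3)); last by ring.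
by rewrite !mulr0 !addr0 in eq4; rewrite eq4; ring.
Qed.

(** Compare the coefficients of [e_6] in the two expressions of the image
of [[e_2, e_3]]. *)
Lemma morph_c23 : c23 C' * entry y 1 = c23 C * entry x 0 ^+ 2.
Proof.
have [y1 x0] := leading_neq0.
have /(congr1 (fun v => entry v 6)) := @morph_basis_prod 2 3 isT isT.
rewrite /= linearZ L_vec entry_vec //=.
have [low2 lead2] := @morph_leading 1 isT.
have [low3 lead3] := @morph_leading 2 isT.
have [_ lead6] := @morph_leading 5 isT.
have -> : entry (c23 C *: f (e K 6)) 6 = c23 C * entry (f (e K 6)) 6.
  by rewrite /entry mxE.
rewrite !(low2 0) // !(low2 1) // !(low3 0) // !(low3 1) // !(low3 2) //.
rewrite lead2 lead3 lead6 => eq6.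
apply: (mulfI (expf_neq0 3 x0)); apply: (mulfI y1).
by transitivity (c23 C * (entry y 1 * entry x 0 ^+ 5)); [rewrite eq6|]; ring.
Qed.

End Necessity.

Lemma iso_ratio (K : fieldType) (C C' : params K) :
  U73 C -> U73 C' -> alg_isomorphic (L C) (L C') ->
  c12 C' / c23 C' = c12 C / c23 C.
Proof.
move=> [s0 [[C11 _] _]] [s0' [[C'11 C'01] [_ C'00]]] [f [/bij_inj f_inj fM]].
have [y1 x0] := leading_neq0 f_inj fM C11 C'00 C'01 C'11.
have e12 := morph_c12 f_inj fM C11 C'00 C'01 C'11.
have e23 := morph_c23 f_inj fM C11 C'00 C'01 C'11.
rewrite -(mulfK y1 (c12 C')) -(mulfK y1 (c23 C')) e12 e23.
by field; rewrite s0 y1 x0.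
Qed.

Theorem proposition2p3 (R : realType) :
  (forall C C' : params R[i], U73 C -> U73 C' ->
     (alg_isomorphic (L C) (L C') <-> c12 C' / c23 C' = c12 C / c23 C)) /\
  (forall lambda : R[i], lambda != 0 ->
     exists C : params R[i], U73 C /\ c12 C / c23 C = lambda) /\
  ((forall lambda : R[i], lambda != 0 -> U73 (Params 1 0 0 lambda 0 0 1)) /\
   (forall C : params R[i], U73 C ->
     exists lambda : R[i], lambda != 0 /\
       alg_isomorphic (L C) (L (Params 1 0 0 lambda 0 0 1)))).
Proof.
have U73_nf (lambda : R[i]) : lambda != 0 -> U73 (Params 1 0 0 lambda 0 0 1).
  by move=> lambda0; rewrite /U73 /= oner_neq0.
split; [|split; [|split]] => //.
- move=> C C' UC UC'; split; first exact: iso_ratio.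
  move=> ratio; apply: alg_isomorphic_trans (normal_form UC) _.
  by rewrite -ratio; apply: alg_isomorphic_sym; exact: normal_form.
- move=> lambda lambda0; exists (Params 1 0 0 lambda 0 0 1).
  by split; [exact: U73_nf | rewrite /= divr1].
- move=> C UC; exists (c12 C / c23 C); split; last exact: normal_form.
  by case: UC => s0 [_ [b0 _]]; rewrite mulf_neq0 ?invr_eq0.
Qed.
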